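(* Let $m\ge 2$ be an integer such that $m\neq 3^k$ for all $k\in\mathbb{N}$, let $T:[0,1]\to[0,1]$, $T(x)=mx \bmod 1$, let $\mu$ be Lebesgue measure on $[0,1]$, and let $\varphi$ be the Cantor ladder function of the ternary Cantor set. Put $X_j=\varphi\circ T^j$ for $j\ge 0$ and $M_N=\max\{X_0,\dots,X_{N-1}\}$. Let $\tau\ge 0$, and for $n\in\mathbb{N}$ let $u_n=n$ and $w_n=\lfloor \tau (3/2)^n\rfloor$. Then $w_n\,\mu(X_0>u_n)\to\tau$ as $n\to\infty$, and moreover $$\lim_{n\to\infty}\mu(M_{w_n}\le n)=e^{-\tau}.$$
   Context: $\mathbb{N}=\{1,2,3,\dots\}$. Ternary Cantor set: $\mathcal{C}_0=[0,1]$, and for $n\ge 1$, $\mathcal{C}_n$ is obtained from $\mathcal{C}_{n-1}$ by removing the open middle third of each connected component of $\mathcal{C}_{n-1}$; $\mathcal{C}=\bigcap_{n\ge1}\mathcal{C}_n$. For $n\ge1$ let $B_n=\mathcal{C}_{n-1}\setminus\mathcal{C}_n$. The Cantor ladder function is $\varphi:[0,1]\to\mathbb{N}\cup\{\infty\}$ with $\varphi(x)=n$ if $x\in B_n$ ($n=1,2,3,\dots$) and $\varphi(x)=\infty$ otherwise (i.e. for $x\in\mathcal{C}$). The event $\{M_0\le u\}$ (maximum over an empty set) is understood to be the whole space. *)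

(* Defs.v *)
From HB Require Import structures.
From mathcomp Require Import all_boot all_order all_algebra.
From mathcomp Require Import all_classical all_reals all_analysis.
Import Order.TTheory GRing.Theory Num.Theory.
Import numFieldNormedType.Exports.

Set Implicit Arguments.
Unset Strict Implicit.
Unset Printing Implicit Defensive.

Local Open Scope classical_set_scope.
Local Open Scope ring_scope.

(* For I an interval with endpoints a = inf I and b = sup I, this is
   ]a + (b - a) / 3, b - (b - a) / 3[. *)
Definition middle_third (R : realType) (I : set R) : set R :=
  [set` `]inf I + (sup I - inf I) / 3%:R, sup I - (sup I - inf I) / 3%:R[].

Fixpoint cantor_step (R : realType) (n : nat) : set R :=
  match n with
  | 0%N => `[0, 1]
  | k.+1 => cantor_step k `\`
      \bigcup_(x in cantor_step k)
        middle_third (connected_component (cantor_step k) x)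
  end.

Definition cantor_set (R : realType) : set R :=
  \bigcap_(n in [set n | (1 <= n)%N]) cantor_step n.

(* Only used for 1 <= n. *)
Definition cantor_gap (R : realType) (n : nat) : set R :=
  cantor_step n.-1 `\` cantor_step n.

(* The gaps are pairwise disjoint, so the index chosen by [cid] is the only
   possible one (see [cantor_ladder_gap]). The function is defined on all of R
   and takes the value +oo outside [0, 1]. *)
Definition cantor_ladder (R : realType) (x : R) : \bar R :=
  match pselect (exists n, (1 <= n)%N /\ cantor_gap n x) with
  | left gap_x => (sval (cid gap_x))%:R%:E
  | right _ => +oo%E
  end.

Definition times_mod1 (R : realType) (m : nat) (x : R) : R :=
  m%:R * x - (Num.floor (m%:R * x))%:~R.

Definition X (R : realType) (m j : nat) (x : R) : \bar R :=
  cantor_ladder (iter j (times_mod1 m) x).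

(* The maximum over the empty set is -oo, so [set x | (M m 0 x <= u)%E] is the
   whole space. *)
Definition M (R : realType) (m N : nat) (x : R) : \bar R :=
  \big[maxe/-oo%E]_(j < N) X m j x.

(* Lebesgue measure on [0, 1], as the measure A |-> lebesgue_measure
   (A `&` `[0, 1]) on R. *)
Definition mu (R : realType) : set R -> \bar R :=
  mrestr (@lebesgue_measure R) (measurable_itv `[(0 : R), 1]).

Definition u (R : realType) (n : nat) : \bar R := n%:R%:E.

Definition w (R : realType) (tau : R) (n : nat) : nat :=
  Num.truncn (tau * (3%:R / 2%:R) ^+ n).

Lemma cantor_step_le (R : realType) (i j : nat) :
  (i <= j)%N -> cantor_step j `<=` (cantor_step i : set R).
Proof.
elim: j => [|j IHj]; first by rewrite leqn0 => /eqP ->.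
rewrite leq_eqVlt => /predU1P[-> //|/IHj jCi] x [/jCi]; exact.
Qed.

Lemma cantor_gap_inj (R : realType) (i j : nat) (x : R) :
  (1 <= i)%N -> (1 <= j)%N -> cantor_gap i x -> cantor_gap j x -> i = j.
Proof.
wlog ltij : i j / (i < j)%N => [wl i1 j1 gi gj|].
  by case: (ltngtP i j) => [/wl->//|/wl<-//|].
case: j ltij => // j; rewrite ltnS => /cantor_step_le/(_ x) ij _ _.
by move=> [_ nCi] [/= /ij Ci _].
Qed.

Lemma cantor_ladder_gap (R : realType) (n : nat) (x : R) :
  (1 <= n)%N -> cantor_gap n x -> cantor_ladder x = n%:R%:E.
Proof.
move=> n1 gx; rewrite /cantor_ladder; case: pselect => [h|[]]; last by exists n.
by case: cid => k /= [k1 kx]; rewrite (cantor_gap_inj k1 n1 kx gx).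
Qed.

Lemma cantor_ladder_pinfty (R : realType) (x : R) :
  0 <= x <= 1 -> cantor_ladder x = +oo%E <-> cantor_set x.
Proof.
move=> x01; rewrite /cantor_ladder; case: pselect => h; split => //.
- by have [n [n1 [_ nCx]]] := h => /(_ n n1)/nCx.
- move=> _ n _; elim: n => [|n IHn]; first by rewrite /= in_itv.
  by apply: contrapT => nC; apply: h; exists n.+1; split => //; split.
Qed.

(* Main.v *)
Require Import Defs.
From mathcomp Require Import all_boot all_order all_algebra.
From mathcomp Require Import all_classical all_reals all_analysis.
From mathcomp Require Import measurable_realfun.
From mathcomp Require Import zify ring lra.
Import Order.TTheory GRing.Theory Num.Theory.
Import numFieldNormedType.Exports.
Local Open Scope classical_set_scope.
Local Open Scope ring_scope.

(** Write C_n for the n-th step of the Cantor construction. Since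
[cantor_ladder x > n] means that x lies in C_n, and C_n has measure
p = (2/3)^n, the first limit is the statement that w_n p tends to tau, and the
second one concerns the measure q_N of the points whose first N iterates avoid
C_n, for N = w_n.

A point avoids C_n up to time N + 1 when it is not in C_n and its image avoids
C_n up to time N; as Lebesgue measure is invariant under T this gives
  q_(N+1) = q_N - mu(C_n /\ T^-1 (no hit up to time N)).
If the last measure were p q_N, then q_N would be (1 - p)^N, which is close to
exp (- N p) and hence to exp (- tau). The error at each step is controlled
([no_hit_exp]) by two quantities, with a waiting time of 2n iterates.

- Mixing: C_n is a union of 2^n intervals and T^L maps every m-adic interval
  of length m^-L affinely onto [0, 1[, so that mu(C_n /\ T^-L B) and p mu(B)
  differ by at most 2^(n+1) m^-L mu(B) ([cantor_dust_mixing]). For L = 2n this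
  is at most 2 (1/2)^n, which is o(p).

- Short returns: the sum over 1 <= j < 2n of mu(C_n /\ T^-j C_n) is also o(p)
  ([sum_returns_cvg0]). Looking only at some of the ternary digits of T^j x and
  applying the same mixing bound to x |-> 3^(n-s) m^j x mod 1, one gets
  mu(C_n /\ T^-j C_n) <= 3 p (2/3)^(j/2), a summable bound uniform in n
  ([leb01_returns_le]). By dominated convergence it is then enough that, for
  each fixed j, mu(C_n /\ T^-j C_n) / p tends to 0 as n grows. This is where
  the hypothesis on m is used: M = m^j is not a power of 3, say
  3^a < M < 3^(a+1), and then multiplication by M sends 3^-(a+1) (if
  M < 2 * 3^a) or 2 * 3^-(a+2) (otherwise), both points of the Cantor set, into
  [1/3, 2/3[. Hence it sends a whole cylinder of the Cantor set there
  ([cantor_codes_middle]). Multiplication by M and by 3 commute modulo 1, so a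
  point of C_n with T^j x in C_n has to avoid this cylinder at every multiple
  of its depth, which costs a factor less than 1 each time
  ([leb01_returns_middle]).

The set C_n is defined by removing the middle thirds of connected components;
it is identified with the points whose first n ternary digits are 0 or 2, up to
finitely many points ([cantor_stepE], [leb01_stepD_dust]). *)

(** * Lebesgue measure on the unit interval *)

(** Real-valued version of [mu]. Points outside of [0, 1[ do not matter, as the
lemmas [leb01E], [leb01_le] and [leb01_eq] express. *)
Definition leb01 {R : realType} (S : set R) : R := fine (mu S).

Section leb01_theory.
Context {R : realType}.
Implicit Types A B S : set R.

Lemma muE A : measurable A -> mu A = lebesgue_measure (A `&` `[0, 1[).
Proof.
move=> mA; rewrite /mu /mrestr.
have mA1 : measurable (A `&` `[0, 1[ : set R).
  by apply: measurableI => //; exact: measurable_itv.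
have mA2 : measurable (A `&` `[0, 1] : set R).
  by apply: measurableI => //; exact: measurable_itv.
apply/eqP; rewrite eq_le; apply/andP; split; last first.
  apply: le_measure; rewrite ?inE// => x [Ax /=]; rewrite !in_itv/= => /andP[x0 x1].
  by split => //; rewrite x0 ltW.
rewrite -[leRHS]adde0 -(lebesgue_measure_set1 (1 : R)).
apply: (le_trans _ (measureU2 _ _ _)) => //.
- apply: le_measure; rewrite ?inE//.
    by apply: measurableU => //; exact: measurable_set1.
  move=> x [Ax /=]; rewrite !in_itv/= => /andP[x0].
  by rewrite le_eqVlt => /predU1P[->|x1]; [right|left; split=> //=; rewrite x0].
Qed.

Lemma mu_fin A : measurable A -> mu A \is a fin_num.
Proof.
move=> mA; rewrite muE//.
have mA1 : measurable (A `&` `[0, 1[ : set R).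
  by apply: measurableI => //; exact: measurable_itv.
rewrite ge0_fin_numE ?measure_ge0//.
apply: (@le_lt_trans _ _ (lebesgue_measure (`[0, 1[ : set R))).
  by apply: le_measure; rewrite ?inE//; move=> x [].
by rewrite lebesgue_measure_itv/= lte01 sube0 ltry.
Qed.

Lemma leb01K A : measurable A -> (leb01 A)%:E = mu A.
Proof. by move=> mA; rewrite /leb01 fineK// mu_fin. Qed.

Lemma leb01E A : measurable A ->
  (leb01 A)%:E = lebesgue_measure (A `&` `[0, 1[).
Proof. by move=> mA; rewrite leb01K// muE. Qed.

Lemma leb01_le A B : measurable A -> measurable B ->
  (forall x, 0 <= x < 1 -> A x -> B x) -> leb01 A <= leb01 B.
Proof.
move=> mA mB AB; rewrite -lee_fin !leb01E//.
apply: le_measure; rewrite ?inE.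
- by apply: measurableI => //; exact: measurable_itv.
- by apply: measurableI => //; exact: measurable_itv.
- by move=> x [Ax /= x01]; split => //; apply: AB => //; move: x01; rewrite in_itv.
Qed.

Lemma leb01_eq A B : measurable A -> measurable B ->
  (forall x, 0 <= x < 1 -> A x <-> B x) -> leb01 A = leb01 B.
Proof.
move=> mA mB AB; apply/eqP; rewrite eq_le !leb01_le// => x x01; apply AB => //.
Qed.

Lemma leb01_ge0 A : 0 <= leb01 A.
Proof. by apply: fine_ge0; rewrite /mu /mrestr; exact: measure_ge0. Qed.

Lemma leb01U A B : measurable A -> measurable B ->
  (forall x, A x -> B x -> False) -> leb01 (A `|` B) = leb01 A + leb01 B.
Proof.
move=> mA mB AB; apply: EFin_inj; rewrite EFinD !leb01E//; last exact: measurableU.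
rewrite setIUl measureU//.
- by apply: measurableI => //; exact: measurable_itv.
- by apply: measurableI => //; exact: measurable_itv.
- by apply/seteqP; split => // x [[/AB + _] [+ _]]; apply.
Qed.

Lemma leb01_setIC A B : measurable A -> measurable B ->
  leb01 (A `&` B) + leb01 (A `&` ~` B) = leb01 A.
Proof.
move=> mA mB; rewrite -leb01U.
- by rewrite -setIUr setUv setIT.
- exact: measurableI.
- by apply: measurableI => //; exact: measurableC.
- by move=> x [_ Bx] [_ /(_ Bx)].
Qed.

Lemma leb01T : leb01 [set: R] = 1.
Proof.
apply: EFin_inj; rewrite leb01E// setTI lebesgue_measure_itv/=.
by rewrite lte01 sube0.
Qed.

Lemma leb01_le1 A : measurable A -> leb01 A <= 1.
Proof. by move=> mA; rewrite -leb01T; apply: leb01_le. Qed.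

Lemma leb01_set0 : leb01 (set0 : set R) = 0.
Proof. by rewrite /leb01 /mu /mrestr set0I measure0. Qed.

Lemma leb01_finite A : finite_set A -> measurable A -> leb01 A = 0.
Proof.
move=> fA mA; apply: EFin_inj; rewrite leb01E//.
apply: countable_lebesgue_measure0; apply: finite_set_countable.
exact: finite_setIl.
Qed.

Lemma leb01_leU B C D : measurable B -> measurable C -> measurable D ->
  (forall x, 0 <= x < 1 -> B x -> C x \/ D x) -> leb01 B <= leb01 C + leb01 D.
Proof.
move=> mB mC mD h; have mDC : measurable (D `&` ~` C).
  by apply: measurableI => //; exact: measurableC.
apply: (@le_trans _ _ (leb01 (C `|` (D `&` ~` C)))).
  apply: leb01_le => //; first exact: measurableU.
  move=> x x01 /(h x x01)[Cx|Dx]; first by left.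
  by have [Cx|nCx] := pselect (C x); [left|right].
rewrite leb01U//; last by move=> x Cx [_ /(_ Cx)].
by rewrite lerD2l; apply: leb01_le => // x _ [].
Qed.

End leb01_theory.

(** * Multiplication by an integer modulo 1 *)
Section times_mod1_theory.
Context {R : realType}.
Implicit Types (A B : set R) (x : R) (M a b : nat).
Local Notation t := (@times_mod1 R).

Lemma times_mod1_itv M x : 0 <= t M x < 1.
Proof.
have /andP[h1 h2] := floor_itv (M%:R * x).
by rewrite /times_mod1 subr_ge0 h1/= ltrBlDl -[ltRHS](@intrD R _ 1).
Qed.

Lemma times_mod1_eq M x (k : int) :
  k%:~R <= M%:R * x < (k + 1)%:~R -> t M x = M%:R * x - k%:~R.
Proof. by move=> h; rewrite /times_mod1 (floor_def h). Qed.

Lemma times_mod1_comp a b x : t a (t b x) = t (a * b) x.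
Proof.
have /andP[h1 h2] := times_mod1_itv a (t b x).
pose k := Num.floor (b%:R * x); pose l := Num.floor (a%:R * t b x).
have e : t a (t b x) = (a * b)%:R * x - (a%:Z * k + l)%:~R.
  by rewrite {1}/times_mod1 -/l /times_mod1 -/k natrM intrD intrM; ring.
rewrite e (@times_mod1_eq _ x (a%:Z * k + l)) //.
by move: h1 h2; rewrite e intrD => h1 h2; apply/andP; split; lra.
Qed.

Lemma times_mod1_1 x : 0 <= x < 1 -> t 1 x = x.
Proof.
by move=> x01; rewrite (@times_mod1_eq _ _ 0) mul1r ?subr0.
Qed.

Lemma iter_times_mod1 M j x : 0 <= x < 1 -> iter j (t M) x = t (M ^ j) x.
Proof.
move=> x01; elim: j => [|j IHj]; first by rewrite expn0 times_mod1_1.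
by rewrite iterS IHj times_mod1_comp expnS.
Qed.

Lemma measurable_times_mod1 M : measurable_fun [set: R] (t M).
Proof.
have mM : measurable_fun [set: R] (fun x : R => M%:R * x).
  by apply: measurable_funM.
have mfl : measurable_fun [set: R] (fun x : R => (Num.floor x)%:~R : R).
  apply: nondecreasing_measurable => // x y xy.
  by rewrite ler_int; exact: le_floor.
apply: measurable_funB => //.
exact: (measurableT_comp mfl mM).
Qed.

Lemma measurable_preim_times_mod1 M B : measurable B -> measurable (t M @^-1` B).
Proof.
by move=> mB; rewrite -[X in measurable X]setTI; exact: measurable_times_mod1.
Qed.

(** The interval [a / M, (a + 1) / M[; for a < M it is one of the M intervals
of equal length that partition [0, 1[. *)
Definition cell M a : set R := [set x | a%:R <= M%:R * x < a.+1%:R].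

Lemma measurable_preim_co (f : R -> R) (c d : R) : measurable_fun [set: R] f ->
  measurable [set x | c <= f x < d].
Proof.
move=> mf; have -> : [set x | c <= f x < d] = f @^-1` `[c, d[.
  by apply/seteqP; split => x /=; rewrite in_itv.
by rewrite -[X in measurable X]setTI; apply: mf.
Qed.

Lemma measurable_fun_scale (M : R) : measurable_fun [set: R] (fun x : R => M * x).
Proof. by apply: measurable_funM. Qed.

Lemma measurable_cell M a : measurable (cell M a).
Proof. by apply: measurable_preim_co; exact: measurable_fun_scale. Qed.

Lemma times_mod1_cell M a x : cell M a x -> t M x = M%:R * x - a%:R.
Proof.
by move=> h; rewrite (@times_mod1_eq _ _ a%:Z)// intrD -[1%:~R]/(1%:R) -natrD addn1.
Qed.

Lemma lebesgue_measure_affine (c e : R) B : 0 < c -> measurable B ->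
  lebesgue_measure B
  = (c%:E * lebesgue_measure [set x | B (c * x - e)%R])%E.
Proof.
move=> c0 mB; pose f : R -> measurableTypeR R := fun x => c * x - e.
have mf : measurable_fun [set: measurableTypeR R] f.
  by apply: measurable_funB => //; exact: measurable_fun_scale.
have h := @lebesgue_measure_unique R
    (mscale (NngNum (ltW c0)) (pushforward (@lebesgue_measure R) f)).
apply: (h mf _ B mB) => _ [[a b]] _ <- /=.
rewrite /mscale/= /pushforward.
have -> : f @^-1` `]a, b] = `]((a + e) / c), ((b + e) / c)]%classic.
  apply/seteqP; split => x /=; rewrite !in_itv/= /f ltrBrDr lerBlDr.
    by rewrite ltr_pdivrMr// ler_pdivlMr// mulrC.
  by rewrite ltr_pdivrMr// ler_pdivlMr// mulrC.
rewrite !lebesgue_measure_itv/= !lte_fin ltr_pM2r ?invr_gt0// ltrD2r.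
case: ifPn => // _; last by rewrite mule0.
by rewrite -!EFinB -EFinM; congr (_%:E); field; rewrite gt_eqF.
Qed.

(** [times_mod1 M] maps each of its M cells affinely onto [0, 1[. *)
Lemma leb01_cell_preim M a B : (a < M)%N -> measurable B ->
  leb01 (cell M a `&` t M @^-1` B) = leb01 B / M%:R.
Proof.
move=> aM mB.
have M0 : 0 < M%:R :> R by rewrite ltr0n (leq_ltn_trans _ aM).
have mB1 : measurable (B `&` `[0, 1[) by apply: measurableI.
apply: EFin_inj; rewrite leb01E; last first.
  by apply: measurableI; [exact: measurable_cell|exact: measurable_preim_times_mod1].
rewrite EFinM leb01E// (lebesgue_measure_affine M%:R a%:R _ M0 mB1).
rewrite muleAC -EFinM mulfV ?gt_eqF// mul1e.
congr (lebesgue_measure _); apply/seteqP; split => x /=.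
  move=> [[cx]]; rewrite (times_mod1_cell _ _ _ cx) => Bx _; split => //.
  by move: cx; rewrite /cell/= in_itv/= subr_ge0 -natr1 ltrBlDl.
move=> [Bx]; rewrite in_itv/= subr_ge0 ltrBlDl natr1 => cx.
split; first by split => //; rewrite (times_mod1_cell _ _ _ cx).
rewrite in_itv/=; move: cx => /andP[x0 x1].
have x00 : 0 <= M%:R * x by rewrite (le_trans _ x0).
have x11 : M%:R * x < M%:R * 1 by rewrite mulr1 (lt_le_trans x1)// ler_nat.
by move: x00 x11; rewrite pmulr_rge0// ltr_pM2l// => -> ->.
Qed.

Lemma measurable_preim_lt (f : R -> R) (d : R) : measurable_fun [set: R] f ->
  measurable [set x | f x < d].
Proof.
move=> mf; have -> : [set x | f x < d] = f @^-1` `]-oo, d[.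
  by apply/seteqP; split => x /=; rewrite in_itv.
by rewrite -[X in measurable X]setTI; apply: mf.
Qed.

Lemma leb01_init_preim M k B : (k <= M)%N -> measurable B ->
  leb01 ([set x | M%:R * x < k%:R] `&` t M @^-1` B) = k%:R / M%:R * leb01 B.
Proof.
move=> + mB; have mtB := measurable_preim_times_mod1 M B mB.
elim: k => [_|k IHk kM].
  rewrite !mul0r -leb01_set0; apply: leb01_eq => //.
    by apply: measurableI => //; apply: measurable_preim_lt; exact: measurable_fun_scale.
  by move=> x /andP[x0 _]; split => // -[/=]; rewrite ltNge mulr_ge0.
rewrite -natr1 !mulrDl mul1r -(IHk (ltnW kM)) [_^-1 * _]mulrC.
rewrite -(leb01_cell_preim _ _ _ kM mB) -leb01U.
- rewrite -setIUl; congr (leb01 (_ `&` _)); apply/seteqP; split => x /=.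
    by case: (ltP (M%:R * x) k%:R) => h1 h2; [left|right; rewrite /cell/= h1 -natr1].
  by move=> [h|/andP[_]]; [rewrite (lt_trans h)// ltrDl|rewrite -natr1].
- by apply: measurableI => //; apply: measurable_preim_lt; exact: measurable_fun_scale.
- by apply: measurableI => //; exact: measurable_cell.
- by move=> x [/= h _] [/andP[]]; rewrite leNgt h.
Qed.

Lemma leb01_preim M B : (0 < M)%N -> measurable B ->
  leb01 (t M @^-1` B) = leb01 B.
Proof.
move=> M0 mB; have mtB := measurable_preim_times_mod1 M B mB.
have M0R : 0 < M%:R :> R by rewrite ltr0n.
have := leb01_init_preim M M B (leqnn _) mB.
rewrite mulfV ?gt_eqF// mul1r => <-; apply: leb01_eq => //.
  by apply: measurableI => //; apply: measurable_preim_lt; exact: measurable_fun_scale.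
by move=> x /andP[x0 x1]; split => [h|[]//]; split => //=; rewrite gtr_pMr.
Qed.

(** The measure of [0, s[ /\ T^-1 B is a monotone function of s which is exactly
s mu(B) at the multiples of 1 / M. *)
Lemma leb01_lt_preim M (s : R) B : (0 < M)%N -> measurable B -> 0 <= s <= 1 ->
  `|leb01 ([set x | x < s] `&` t M @^-1` B) - s * leb01 B| <= leb01 B / M%:R.
Proof.
move=> M0 mB /andP[s0 s1]; have mtB := measurable_preim_times_mod1 M B mB.
have M0R : 0 < M%:R :> R by rewrite ltr0n.
have PB := leb01_ge0 B.
have ms : measurable ([set x | x < s] `&` t M @^-1` B).
  by apply: measurableI => //; apply: measurable_preim_lt.
have Mk k : measurable ([set x | M%:R * x < k%:R] `&` t M @^-1` B).
  by apply: measurableI => //; apply: measurable_preim_lt; exact: measurable_fun_scale.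
have [->|sn1] := eqVneq s 1.
  rewrite (_ : leb01 _ = leb01 (t M @^-1` B)).
    by rewrite leb01_preim// mul1r subrr normr0 divr_ge0.
  apply: leb01_eq => //.
    by apply: measurableI => //; exact: measurable_preim_lt.
  by move=> x /andP[x0 x1]; split => [[]|].
have s1' : s < 1 by rewrite lt_neqAle sn1.
pose k := Num.truncn (M%:R * s).
have Ms0 : 0 <= M%:R * s by rewrite mulr_ge0// ltW.
have /andP[k1 k2] := truncn_itv Ms0.
have kM : (k < M)%N.
  by rewrite -(ltr_nat R) (le_lt_trans k1)// gtr_pMr.
have ks : k%:R / M%:R <= s by rewrite ler_pdivrMr// mulrC.
have sk : s <= k.+1%:R / M%:R by rewrite ler_pdivlMr// mulrC ltW.
have h1 : k%:R / M%:R * leb01 B <= leb01 ([set x | x < s] `&` t M @^-1` B).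
  rewrite -(leb01_init_preim _ _ _ (ltnW kM))//; apply: leb01_le => // x _ [/= h ?].
  by split => //=; rewrite -(ltr_pM2l M0R) (lt_le_trans h).
have h2 : leb01 ([set x | x < s] `&` t M @^-1` B) <= k.+1%:R / M%:R * leb01 B.
  rewrite -(leb01_init_preim _ _ _ kM)//; apply: leb01_le => // x _ [/= h ?].
  by split => //=; rewrite (lt_trans _ k2)// ltr_pM2l.
have e : k.+1%:R / M%:R = k%:R / M%:R + 1 / M%:R :> R by rewrite -natr1 mulrDl.
have h3 := ler_wpM2r PB ks; have h4 := ler_wpM2r PB sk.
rewrite e !mulrDl mul1r in h2 h4; rewrite ler_norml [_ / M%:R]mulrC.
by apply/andP; split; lra.
Qed.

Lemma leb01_itv_preim M (c d : R) B : (0 < M)%N -> measurable B ->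
  0 <= c -> c <= d -> d <= 1 ->
  `|leb01 ([set x | c <= x < d] `&` t M @^-1` B) - (d - c) * leb01 B|
    <= 2 * (leb01 B / M%:R).
Proof.
move=> M0 mB c0 cd d1; have mtB := measurable_preim_times_mod1 M B mB.
have hc : 0 <= c <= 1 by rewrite c0 (le_trans cd).
have hd : 0 <= d <= 1 by rewrite d1 (le_trans c0).
have := leb01_lt_preim M c B M0 mB hc; have := leb01_lt_preim M d B M0 mB hd.
have -> : leb01 ([set x | x < d] `&` t M @^-1` B) =
  leb01 ([set x | c <= x < d] `&` t M @^-1` B) +
  leb01 ([set x | x < c] `&` t M @^-1` B).
  rewrite -leb01U.
  - rewrite -setIUl; congr (leb01 (_ `&` _)); apply/seteqP; split => x /=.
      by case: (ltP x c) => h1 h2; [right|left; rewrite h2].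
    by move=> [/andP[]//|h]; rewrite (lt_le_trans h).
  - by apply: measurableI => //; exact: measurable_preim_co.
  - by apply: measurableI => //; exact: measurable_preim_lt.
  - by move=> x [/= /andP[h _] _] [/=]; rewrite ltNge h.
rewrite !ler_norml => /andP[h1 h2] /andP[h3 h4].
by apply/andP; split; lra.
Qed.

End times_mod1_theory.

(** * Ternary digits and mixing *)

(** The integers below 3^n all of whose n ternary digits are 0 or 2. They index
the triadic intervals of length 3^-n that make up the n-th step of the Cantor
construction. *)
Fixpoint cantor_codes (n : nat) : seq nat :=
  if n is k.+1 then
    [seq (3 * e)%N | e <- cantor_codes k] ++ [seq (3 * e).+2 | e <- cantor_codes k]
  else [:: 0%N].

Lemma size_cantor_codes n : size (cantor_codes n) = (2 ^ n)%N.
Proof.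
by elim: n => //= n IHn; rewrite size_cat !size_map IHn addnn expnS mul2n.
Qed.

Lemma cantor_codes_lt n e : e \in cantor_codes n -> (e < 3 ^ n)%N.
Proof.
elim: n e => [|n IHn] e /=; first by rewrite inE => /eqP ->.
by rewrite mem_cat expnS => /orP[] /mapP[f /IHn fn ->]; lia.
Qed.

(** The points of [0, 1[ whose first n ternary digits all differ from 1: the
half-open version of [cantor_step n]. The digit of index k, counted from 0,
differs from 1 when 3^k x mod 1 is not in [1/3, 2/3[, that is [cell 3 1]. *)
Definition cantor_dust {R : realType} (n : nat) : set R :=
  [set x | 0 <= x < 1 /\
    forall k, (k < n)%N -> ~ cell 3 1 (times_mod1 (3 ^ k) x)].

Section cantor_dust_theory.
Context {R : realType}.
Implicit Types (A B S : set R) (x : R) (M n e : nat).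
Local Notation t := (@times_mod1 R).
Local Notation dust := (@cantor_dust R).

Lemma cantor_dustD r n x : dust (r + n) x <-> dust r x /\ dust n (t (3 ^ r) x).
Proof.
split.
  move=> [x01 h]; split.
    by split => // k kr; apply: h; rewrite ltn_addr.
  split; first exact: times_mod1_itv.
  by move=> k kn; rewrite times_mod1_comp -expnD addnC; apply: h; rewrite ltn_add2l.
move=> [[x01 h1] [_ h2]]; split => // k krn.
have [/h1//|rk] := ltnP k r.
have kn : (k - r < n)%N by rewrite ltn_subLR.
by have := h2 _ kn; rewrite times_mod1_comp -expnD subnK.
Qed.

Lemma cantor_dustS n x : dust n.+1 x <-> dust n x /\ ~ cell 3 1 (t (3 ^ n) x).
Proof.
rewrite -addn1 cantor_dustD; split => -[h1 h2]; split => //.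
  by have := h2.2 0%N isT; rewrite times_mod1_comp expn0 mul1n.
split; first exact: times_mod1_itv.
by move=> [|//] _; rewrite times_mod1_comp expn0 mul1n.
Qed.

Lemma measurable_cantor_dust n : measurable (dust n).
Proof.
elim: n => [|n IHn].
  have -> : dust 0 = `[0, 1[%classic.
    by apply/seteqP; split => x /=; rewrite in_itv/=; [case|split].
  exact: measurable_itv.
have -> : dust n.+1 = dust n `&` ~` (t (3 ^ n) @^-1` cell 3 1).
  by apply/seteqP; split => x /cantor_dustS.
apply: measurableI => //; apply: measurableC.
by apply: measurable_preim_times_mod1; exact: measurable_cell.
Qed.

Lemma cell3 (N e : nat) x : cell N e x ->
  ~ cell 3 1 (t N x) <-> cell (3 * N) (3 * e) x \/ cell (3 * N) (3 * e).+2 x.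
Proof.
move=> cx; rewrite (times_mod1_cell _ _ _ cx); move: cx.
rewrite /cell/= !natrM -!natr1 !natrM => /andP[h1 h2].
have [h3|h3] := ltP (3%:R * (N%:R * x - e%:R)) 1.
  split => [_|_ /andP[h5 h6]]; last by lra.
  by left; apply/andP; split; lra.
have [h4|h4] := ltP (3%:R * (N%:R * x - e%:R)) 2.
  split; first by case; apply/andP; split; lra.
  by move=> [/andP[h5 h6]|/andP[h5 h6]]; exfalso; lra.
split => [_|_ /andP[h5 h6]]; last by lra.
by right; apply/andP; split; lra.
Qed.

Lemma cell3_sub (N e i : nat) x : (i < 3)%N ->
  cell (3 * N) (3 * e + i) x -> cell N e x.
Proof.
rewrite /cell/= -!natr1 natrD !natrM => i3 /andP[h1 h2].
have i0 : 0 <= i%:R :> R by [].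
have i2 : i%:R <= 2 :> R by rewrite ler_nat.
by apply/andP; split; lra.
Qed.

Lemma cantor_dustP n x :
  dust n x <-> exists2 e, e \in cantor_codes n & cell (3 ^ n) e x.
Proof.
elim: n => [|n IHn].
  split; first by move=> [x01 _]; exists 0%N; rewrite ?inE// /cell/= mul1r.
  by move=> [e]; rewrite inE /cell/= => /eqP -> ; rewrite mul1r.
rewrite cantor_dustS; split.
  move=> [/IHn[e en cx]]; rewrite (cell3 _ _ _ cx) => h; rewrite expnS.
  case: h => h; [exists (3 * e)%N|exists (3 * e).+2] => //=.
    by rewrite mem_cat map_f.
  by rewrite mem_cat (map_f (fun e => (3 * e).+2)) ?orbT.
move=> [f /=]; rewrite mem_cat => /orP[] /mapP[e en ->]; rewrite expnS => h.
  have cx : cell (3 ^ n) e x.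
    by apply: (cell3_sub _ _ 0) => //; rewrite addn0.
  by split; [apply/IHn; exists e|rewrite (cell3 _ _ _ cx); left].
have cx : cell (3 ^ n) e x by apply: (cell3_sub _ _ 2) => //; rewrite addn2.
by split; [apply/IHn; exists e|rewrite (cell3 _ _ _ cx); right].
Qed.

Lemma leb01_cantor_dustI n S : measurable S ->
  leb01 (dust n `&` S) = \sum_(e <- cantor_codes n) leb01 (cell (3 ^ n) e `&` S).
Proof.
elim: n S => [|n IHn] S mS.
  rewrite /= big_seq1; apply: leb01_eq => //.
  - by apply: measurableI => //; exact: measurable_cantor_dust.
  - by apply: measurableI => //; exact: measurable_cell.
  - move=> x x01; rewrite /cell; split => -[h Sx]; split => //=; first by rewrite mul1r.
pose S' := ~` (t (3 ^ n) @^-1` cell 3 1) `&` S.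
have mS' : measurable S'.
  apply: measurableI => //; apply: measurableC.
  by apply: measurable_preim_times_mod1; exact: measurable_cell.
have -> : dust n.+1 `&` S = dust n `&` S'.
  rewrite /S' setIA; congr (_ `&` S).
  by apply/seteqP; split => x /cantor_dustS.
rewrite IHn//= big_cat/= !big_map -big_split/=; apply: eq_bigr => e _.
have mc N f : measurable (cell N f `&` S).
  by apply: measurableI => //; exact: measurable_cell.
rewrite expnS -leb01U//; last first.
  move=> x [+ _] [+ _]; rewrite /cell/= -!natr1 => /andP[_ h1] /andP[h2 _].
  by lra.
rewrite -setIUl /S' setIA; congr (leb01 (_ `&` S)).
apply/seteqP; split => x.
  by move=> [cx /(cell3 _ _ _ cx)].
move=> h; have cx : cell (3 ^ n) e x.
  case: h => h; first by apply: (cell3_sub _ _ 0) => //; rewrite addn0.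
  by apply: (cell3_sub _ _ 2) => //; rewrite addn2.
by split => //; apply/(cell3 _ _ _ cx).
Qed.

(** The first n ternary digits are independent of the following ones. *)
Lemma leb01_cantor_dust_preim n B : measurable B ->
  leb01 (dust n `&` t (3 ^ n) @^-1` B) = (2 / 3) ^+ n * leb01 B.
Proof.
move=> mB; rewrite leb01_cantor_dustI; last exact: measurable_preim_times_mod1.
under eq_big_seq => e en do rewrite leb01_cell_preim ?cantor_codes_lt//.
rewrite big_const_seq count_predT size_cantor_codes iter_addr_0.
by rewrite -[LHS]mulr_natl !natrX expr_div_n; ring.
Qed.

Lemma leb01_cantor_dust n : leb01 (dust n) = (2 / 3) ^+ n.
Proof.
have := leb01_cantor_dust_preim n [set: R] measurableT.
by rewrite preimage_setT setIT leb01T mulr1.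
Qed.

(** [cantor_dust n] consists of 2^n intervals, each of which contributes at most
2 mu(B) / M to the error. The integer M is arbitrary: below, it is either a
power of m or a power of m times a power of 3. *)
Lemma cantor_dust_mixing M n B : (0 < M)%N -> measurable B ->
  `|leb01 (dust n `&` t M @^-1` B) - (2 / 3) ^+ n * leb01 B|
  <= 2 ^+ n * (2 * (leb01 B / M%:R)).
Proof.
move=> M0 mB; have mtB := measurable_preim_times_mod1 M B mB.
rewrite leb01_cantor_dustI//.
have -> : (2 / 3) ^+ n * leb01 B
    = \sum_(e <- cantor_codes n) (e.+1%:R / 3 ^+ n - e%:R / 3 ^+ n) * leb01 B.
  under eq_bigr do rewrite -mulrBl -natr1 addrAC subrr add0r.
  rewrite big_const_seq count_predT size_cantor_codes iter_addr_0.
  by rewrite -[RHS]mulr_natl !natrX expr_div_n; ring.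
rewrite -sumrB (le_trans (ler_norm_sum _ _ _))//.
have -> : 2 ^+ n * (2 * (leb01 B / M%:R))
   = \sum_(e <- cantor_codes n) 2 * (leb01 B / M%:R).
  rewrite big_const_seq count_predT size_cantor_codes iter_addr_0.
  by rewrite -[RHS]mulr_natl natrX.
have p3 : 0 < 3 ^+ n :> R by rewrite exprn_gt0.
rewrite big_seq [leRHS]big_seq; apply: ler_sum => e en.
have -> : cell (3 ^ n) e = [set x | e%:R / 3 ^+ n <= x < e.+1%:R / 3 ^+ n] :> set R.
  apply/seteqP; split => x /=; rewrite /cell/= natrX.
    by rewrite ler_pdivrMr// ltr_pdivlMr// mulrC.
  by rewrite ler_pdivrMr// ltr_pdivlMr// mulrC.
apply: leb01_itv_preim => //.
  by rewrite ler_pM2r ?invr_gt0// ler_nat.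
by rewrite ler_pdivrMr// mul1r -natrX ler_nat cantor_codes_lt.
Qed.

End cantor_dust_theory.

(** * Short returns *)
Lemma cantor_codes0 n : 0%N \in cantor_codes n.
Proof.
elim: n => //= n IHn; rewrite mem_cat; apply/orP; left.
by apply/mapP; exists 0%N.
Qed.

Lemma cantor_codesS0 n e : e \in cantor_codes n -> (3 * e)%N \in cantor_codes n.+1.
Proof. by move=> en /=; rewrite mem_cat map_f. Qed.

Lemma cantor_codesS2 n e : e \in cantor_codes n -> (3 * e).+2 \in cantor_codes n.+1.
Proof. by move=> en /=; rewrite mem_cat (map_f (fun e => (3 * e).+2)) ?orbT. Qed.

(** If M lies strictly between two consecutive powers of 3, then x |-> M x sends
some interval of a step of the Cantor construction, [v / 3^(r+1), (v+1) / 3^(r+1)[,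
into [1/3, 2/3[. *)
Lemma cantor_codes_middle (a M : nat) : (3 ^ a < M < 3 ^ a.+1)%N ->
  exists r v, [/\ v \in cantor_codes r.+1,
    (3 ^ r.+1 <= 3 * M * v)%N & (3 * M * v.+1 <= 2 * 3 ^ r.+1)%N].
Proof.
move=> /andP[aM Ma].
have codes_nines k : (3 ^ k).-1 \in cantor_codes (k + a.+1).
  elim: k => [|k IHk]; first exact: cantor_codes0.
  rewrite addSn (_ : (3 ^ k.+1).-1 = (3 * (3 ^ k).-1).+2); first exact: cantor_codesS2.
  by have := expn_gt0 3 k; rewrite expnS; lia.
have codes_two k : (2 * 3 ^ k)%N \in cantor_codes (k + a.+2).
  elim: k => [|k IHk].
    exact: (cantor_codesS2 _ _ (cantor_codes0 a.+1)).
  by rewrite addSn expnS mulnCA; exact: cantor_codesS0.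
have p3 := expn_gt0 3 a.
have [M2|M2] := ltnP M (2 * 3 ^ a).
(* The interval has right end point 3^-(a+1) here, and left end point
   2 * 3^-(a+2) in the other case. *)
  exists (a.+1 + a)%N, (3 ^ a.+1).-1; rewrite -addnS; split => //.
    by rewrite expnD; move: aM M2 p3; rewrite expnS; nia.
  by rewrite prednK ?expn_gt0// expnD expnS; move: aM M2 p3; nia.
exists (a.+1 + a.+1)%N, (2 * 3 ^ a.+1)%N; rewrite -addnS; split => //.
  by rewrite expnD !expnS; move: M2 p3; nia.
by rewrite expnD; move: Ma p3; rewrite !expnS; nia.
Qed.

Section returns.
Context {R : realType}.
Implicit Types (x : R) (M n : nat).
Local Notation t := (@times_mod1 R).
Local Notation dust := (@cantor_dust R).

(** The points of [cantor_dust n] that x |-> M x mod 1 sends back to it; with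
M = m^j these are the returns at time j. *)
Definition returns M n : set R := dust n `&` t M @^-1` dust n.

Lemma measurable_returns M n : measurable (returns M n).
Proof.
apply: measurableI; first exact: measurable_cantor_dust.
by apply: measurable_preim_times_mod1; exact: measurable_cantor_dust.
Qed.

(** If x is a return, then the last s of the first n ternary digits of M x mod 1
are 0 or 2, which says that 3^(n-s) M x mod 1 is in [cantor_dust s]. The factor
3^(n-s) M is at least 3^n, so that the mixing error has the order of the main
term. *)
Lemma leb01_returns_le M n s : (3 ^ s <= M)%N -> (s <= n)%N ->
  leb01 (returns M n) <= 3 * (2 / 3) ^+ n * (2 / 3) ^+ s.
Proof.
move=> sM sn.
have M0 : (0 < 3 ^ (n - s) * M)%N.
  by rewrite muln_gt0 expn_gt0/= (leq_trans _ sM)// expn_gt0.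
have ms := @measurable_cantor_dust R s.
have := cantor_dust_mixing (3 ^ (n - s) * M) n (dust s) M0 ms.
rewrite leb01_cantor_dust ler_norml => /andP[_ h].
have h1 : leb01 (returns M n) <= leb01 (dust n `&` t (3 ^ (n - s) * M) @^-1` dust s).
  apply: leb01_le.
  - exact: measurable_returns.
  - apply: measurableI; first exact: measurable_cantor_dust.
    exact: measurable_preim_times_mod1.
  - move=> x _ [dx /= dtx]; split => //=.
    by move: dtx; rewrite -{1}(subnK sn) => /cantor_dustD[_]; rewrite times_mod1_comp.
have h2 : 2 ^+ n / (3 ^ (n - s) * M)%:R <= (2 / 3) ^+ n :> R.
  rewrite expr_div_n ler_pM2l ?exprn_gt0// lef_pV2 ?posrE ?ltr0n// ?exprn_gt0//.
  by rewrite -natrX ler_nat -{1}(subnK sn) expnD leq_mul.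
have p0 : 0 <= (2 / 3) ^+ s :> R by rewrite exprn_ge0.
have h3 := ler_wpM2r p0 h2.
lra.
Qed.

(** Multiplications by M and by 3^r commute modulo 1. *)
Lemma returns_shift M n r x : returns M (r + n) x -> returns M n (t (3 ^ r) x).
Proof.
move=> [/cantor_dustD[_ h1] /= /cantor_dustD[_ h2]]; split => //=.
by rewrite times_mod1_comp mulnC -times_mod1_comp.
Qed.

Lemma leb01_returnsD M n r :
  leb01 (returns M (r + n)) <= (2 / 3) ^+ r * leb01 (returns M n).
Proof.
have mr := measurable_returns M n.
rewrite -leb01_cantor_dust_preim//; apply: leb01_le.
- exact: measurable_returns.
- apply: measurableI; first exact: measurable_cantor_dust.
  exact: measurable_preim_times_mod1.
- move=> x _ h; split; last exact: returns_shift.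
  by case: h => /cantor_dustD[].
Qed.

(** A point whose first ternary digits are those of v is not a return, because
M x mod 1 then starts with the digit 1. So one of the 2^(r+1) words of r + 1
digits 0 and 2 is forbidden. *)
Lemma leb01_returns_middle M r v n : v \in cantor_codes r.+1 ->
  (3 ^ r.+1 <= 3 * M * v)%N -> (3 * M * v.+1 <= 2 * 3 ^ r.+1)%N ->
  leb01 (returns M (r.+1 + n))
    <= (1 - 2^-1 ^+ r.+1) * (2 / 3) ^+ r.+1 * leb01 (returns M n).
Proof.
move=> vr v1 v2.
have mr := measurable_returns M n.
have mt := measurable_preim_times_mod1 (3 ^ r.+1) _ mr.
have mc := @measurable_cell R (3 ^ r.+1) v.
have md := @measurable_cantor_dust R r.+1.
have vM x : cell (3 ^ r.+1) v x -> cell 3 1 (t M x).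
  rewrite -(ler_nat R) !natrM in v1; rewrite -(ler_nat R) !natrM in v2.
  have p3 : 0 < (3 ^ r.+1)%:R :> R by rewrite ltr0n expn_gt0.
  move: v1 v2; rewrite /cell/=; move: p3.
  set N := (3 ^ r.+1)%:R => p3 v1 v2 /andP[h1 h2].
  have M0 : 0 < M%:R :> R.
    rewrite lt0r ler0n andbT; apply/eqP => M0; move: v1; rewrite M0.
    by move: p3; rewrite /N; lra.
  have k1 : M%:R * v%:R <= M%:R * (N * x) by rewrite ler_pM2l.
  have k2 : M%:R * (N * x) < M%:R * v.+1%:R by rewrite ltr_pM2l.
  have k3 : N * 1 <= N * (3 * (M%:R * x)) by move: v1 k1; lra.
  have k4 : N * (3 * (M%:R * x)) < N * 2 by move: v2 k2; lra.
  rewrite ler_pM2l// in k3; rewrite ltr_pM2l// in k4.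
  rewrite (@times_mod1_eq _ _ _ 0) ?subr0; first by rewrite k3 k4.
  by apply/andP; split; rewrite ?add0r; lra.
have sub : leb01 (returns M (r.+1 + n)) <=
    leb01 ((dust r.+1 `&` t (3 ^ r.+1) @^-1` returns M n) `&` ~` cell (3 ^ r.+1) v).
  apply: leb01_le.
  - exact: measurable_returns.
  - by apply: measurableI; [exact: measurableI|exact: measurableC].
  - move=> x x01 h; split.
      by split; [case: h => /cantor_dustD[]|exact: returns_shift].
    move=> /vM; have [_ /= [_ /(_ 0%N isT)]] := h.
    by rewrite times_mod1_comp expn0 mul1n.
apply: (le_trans sub).
have := leb01_setIC (dust r.+1 `&` t (3 ^ r.+1) @^-1` returns M n) (cell (3 ^ r.+1) v).
have -> : dust r.+1 `&` t (3 ^ r.+1) @^-1` returns M n `&` cell (3 ^ r.+1) v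
    = cell (3 ^ r.+1) v `&` t (3 ^ r.+1) @^-1` returns M n.
  apply/seteqP; split => x; first by move=> [[]].
  by move=> [h1 h2]; split => //; split => //; apply/cantor_dustP; exists v.
rewrite leb01_cell_preim ?cantor_codes_lt// leb01_cantor_dust_preim// => h.
have mI : measurable (dust r.+1 `&` t (3 ^ r.+1) @^-1` returns M n) by apply: measurableI.
have {h} h := h mI mc.
rewrite mulrBl mul1r -exprMn (_ : 2^-1 * (2 / 3) = 3^-1 :> R); last by field.
rewrite natrX in h; rewrite exprVn mulrBl; lra.
Qed.

End returns.

(** This is where m is required not to be a power of 3: as 3 is prime, the
powers of m are not powers of 3 either. *)
Lemma pow_not_power3 m j : (2 <= m)%N ->
  (forall k : nat, (1 <= k)%N -> m <> (3 ^ k)%N) -> (1 <= j)%N ->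
  exists a, (3 ^ a < m ^ j < 3 ^ a.+1)%N.
Proof.
move=> m2 m3 j1; have mj0 : (0 < m ^ j)%N by rewrite expn_gt0; lia.
have /andP[h1 h2] := @trunc_log_bounds 3 _ isT mj0.
exists (trunc_log 3 (m ^ j)); rewrite h2 andbT ltn_neqAle h1 andbT.
apply/eqP => e.
have : (m %| 3 ^ trunc_log 3 (m ^ j))%N by rewrite e dvdn_exp.
move/(dvdn_pfactor _ _ (isT : prime 3)) => [[|b] _ mb]; last exact: (m3 b.+1).
by move: m2; rewrite mb.
Qed.

Section short_returns.
Context {R : realType}.
Local Notation dust := (@cantor_dust R).

Lemma returns_cvg0 M : (exists a, (3 ^ a < M < 3 ^ a.+1)%N) ->
  leb01 (@returns R M n) / (2 / 3) ^+ n @[n --> \oo] --> (0 : R).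
Proof.
move=> [a /cantor_codes_middle[r [v [vr v1 v2]]]].
pose f n := leb01 (@returns R M n) / (2 / 3) ^+ n.
have p0 n : 0 < (2 / 3) ^+ n :> R by rewrite exprn_gt0.
have f0 n : 0 <= f n by rewrite divr_ge0// ?leb01_ge0// ltW.
have fS n : f n.+1 <= f n.
  rewrite /f ler_pdivrMr// exprS mulrCA divfK ?gt_eqF//.
  by have := @leb01_returnsD R M n 1; rewrite add1n expr1.
have fle i j : (i <= j)%N -> f j <= f i.
  by move=> /subnKC <-; elim: (j - i)%N => [|k IHk]; rewrite ?addn0//
    addnS (le_trans (fS _)).
pose q : R := 1 - 2^-1 ^+ r.+1.
have q1 : `|q| < 1.
  have h1 : 0 < 2^-1 ^+ r.+1 :> R by rewrite exprn_gt0.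
  have h2 : 2^-1 ^+ r.+1 <= 1 :> R by rewrite exprn_ile1// invr_le1 ?unitfE// ler1n.
  by rewrite ger0_norm /q; lra.
have q0 : 0 <= q.
  by rewrite /q subr_ge0 exprn_ile1// invr_le1 ?unitfE// ler1n.
have fr n : f (r.+1 + n)%N <= q * f n.
  rewrite /f ler_pdivrMr// exprD.
  rewrite (_ : _ * _ * (_ * _) = q * (2 / 3) ^+ r.+1 * leb01 (@returns R M n)).
    exact: (leb01_returns_middle _ _ _ _ vr v1 v2).
  by field; rewrite gt_eqF.
have fq k : f (k * r.+1)%N <= q ^+ k.
  elim: k => [|k IHk].
    by rewrite mul0n /f !expr0 divr1 leb01_le1//; exact: measurable_returns.
  by rewrite mulSn (le_trans (fr _))// exprS ler_wpM2l.
apply/cvgrPdist_lt => e e0.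
have /cvgrPdist_lt/(_ e e0)[k _ hk] := cvg_expr q1.
exists (k * r.+1)%N => // n /= kn.
rewrite sub0r normrN ger0_norm; last exact: f0.
apply: (le_lt_trans (fle _ _ kn)); apply: (le_lt_trans (fq k)).
by have := hk k (leqnn k); rewrite /= sub0r normrN ger0_norm// exprn_ge0.
Qed.

Lemma sum_half_geometric (K n : nat) : (K <= n)%N ->
  \sum_(2 * K <= j < 2 * n) 3 * (2 / 3) ^+ j./2 = 18 * ((2 / 3) ^+ K - (2 / 3) ^+ n) :> R.
Proof.
move=> /subnKC <-; elim: (n - K)%N => [|k IHk].
  by rewrite addn0 big_geq// subrr mulr0.
rewrite addnS mulnS add2n !big_nat_recr ?IHk//=; [|lia..].
have -> : uphalf (2 * (K + k)) = (K + k)%N by lia.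
have -> : (2 * (K + k))./2 = (K + k)%N by lia.
by rewrite exprS; field.
Qed.

(** Dominated convergence for the sum over the times j < 2n: the terms tend to 0
for every j and are bounded by 3 (2/3)^(j/2), uniformly in n. *)
Lemma sum_returns_cvg0 m : (2 <= m)%N ->
  (forall k : nat, (1 <= k)%N -> m <> (3 ^ k)%N) ->
  (\sum_(1 <= j < 2 * n) leb01 (@returns R (m ^ j) n)) / (2 / 3) ^+ n
    @[n --> \oo] --> (0 : R).
Proof.
move=> m2 m3.
have p0 n : 0 < (2 / 3) ^+ n :> R by rewrite exprn_gt0.
pose f j n := leb01 (@returns R (m ^ j) n) / (2 / 3) ^+ n.
have f0 j n : 0 <= f j n by rewrite divr_ge0// ?leb01_ge0// ltW.
(* 3^(j/2) <= 4^(j/2) <= 2^j <= m^j, and j < 2n gives j/2 <= n. *)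
have fle j n : (j < 2 * n)%N -> f j n <= 3 * (2 / 3) ^+ j./2.
  move=> jn; rewrite /f ler_pdivrMr// mulrAC.
  apply: leb01_returns_le; last by lia.
  apply: (@leq_trans (4 ^ j./2)%N); first by case: j./2 => // k; rewrite leq_exp2r.
  rewrite -[4%N]/(2 ^ 2)%N -expnM.
  apply: (@leq_trans (2 ^ j)%N); first by rewrite leq_exp2l//; lia.
  by case: (j) => // k; rewrite leq_exp2r.
have fcvg k : \sum_(1 <= j < k.+1) f j n @[n --> \oo] --> (0 : R).
  elim: k => [|k IHk].
    under eq_fun do rewrite big_geq//; exact: cvg_cst.
  under eq_fun do rewrite big_nat_recr//.
  have hk : f k.+1 n @[n --> \oo] --> (0 : R).
    exact: (returns_cvg0 (m ^ k.+1) (pow_not_power3 m k.+1 m2 m3 isT)).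
  by have := cvgD IHk hk; rewrite addr0; apply.
under eq_fun do rewrite mulr_suml.
apply/cvgrPdist_lt => e e0.
have q1 : `|2 / 3 : R| < 1 by rewrite ger0_norm; lra.
have e36 : 0 < e / 36 by lra.
have /cvgrPdist_lt/(_ _ e36)[K0 _ hK0] := cvg_expr q1.
pose K := K0.+1.
(* the tail of the series from 2K on is at most 18 (2/3)^K *)
have hK : 18 * (2 / 3) ^+ K < e / 2.
  have := hK0 K (leqnSn _); rewrite /= sub0r normrN gtr0_norm//; lra.
have e2 : 0 < e / 2 by lra.
have /cvgrPdist_lt/(_ _ e2)[n0 _ hn0] := fcvg (2 * K).-1.
exists (maxn n0 K) => // n /=; rewrite geq_max => /andP[n0n Kn].
rewrite sub0r normrN ger0_norm; last by apply: sumr_ge0 => i _; exact: f0.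
rewrite (@big_cat_nat _ _ _ (2 * K)%N)//=; last by rewrite leq_mul2l.
have := hn0 n n0n; rewrite (_ : (2 * K).-1.+1 = 2 * K)%N; last by rewrite /K; lia.
rewrite /= sub0r normrN.
rewrite ger0_norm; last by apply: sumr_ge0 => i _; exact: f0.
have : \sum_(2 * K <= j < 2 * n) f j n <= \sum_(2 * K <= j < 2 * n) 3 * (2 / 3) ^+ j./2.
  rewrite big_nat [leRHS]big_nat; apply: ler_sum => j /andP[_ jn]; exact: fle.
rewrite (sum_half_geometric _ _ Kn) => h1 h2.
have p := p0 n.
apply: (@lt_le_trans _ _ (e / 2 + e / 2)); last by lra.
by apply: ltr_leD => //; apply: (le_trans h1); lra.
Qed.

End short_returns.

(** * Exponential law for the hitting time of a mixing set *)
Section hitting.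
Context {R : realType}.
Implicit Types (A B C D : set R) (x : R) (m n N L : nat).
Local Notation t := (@times_mod1 R).

(** The points whose first N iterates under [times_mod1 m], starting with the
point itself, avoid A. *)
Definition no_hit m A N : set R :=
  [set x | forall i, (i < N)%N -> ~ A (iter i (t m) x)].

Lemma no_hitP m A N x : 0 <= x < 1 ->
  no_hit m A N x <-> forall i, (i < N)%N -> ~ A (t (m ^ i) x).
Proof.
by move=> x01; split => h i /h; rewrite iter_times_mod1.
Qed.

Lemma measurable_iter_times_mod1 m i : measurable_fun [set: R] (iter i (t m)).
Proof.
elim: i => [|i IHi]; first exact: measurable_id.
exact: (measurableT_comp (measurable_times_mod1 m) IHi).
Qed.

Lemma measurable_no_hit m A N : measurable A -> measurable (no_hit m A N).
Proof.
move=> mA; elim: N => [|N IHN].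
  by rewrite (_ : no_hit m A 0 = [set: R])//; apply/seteqP; split.
rewrite (_ : no_hit m A N.+1 = no_hit m A N `&` ~` (iter N (t m) @^-1` A)).
  apply: measurableI => //; apply: measurableC.
  by rewrite -[X in measurable X]setTI; exact: measurable_iter_times_mod1.
apply/seteqP; split => x h.
  by split => [i iN|]; apply: h; rewrite // ltnS ltnW.
move=> i; rewrite ltnS leq_eqVlt => /predU1P[->|iN]; first exact: h.2.
exact: h.1.
Qed.

(** The points of A that come back to A at some time between 1 and k. *)
Definition early_hit m A k : set R :=
  [set x | A x /\ exists2 i, (1 <= i <= k)%N & A (t (m ^ i) x)].

Lemma early_hitS m A k : early_hit m A k.+1
  = early_hit m A k `|` (A `&` t (m ^ k.+1) @^-1` A).
Proof.
apply/seteqP; split => x.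
  move=> [Ax [i /andP[i1]]]; rewrite leq_eqVlt => /predU1P[->|ik] Ai; first by right.
  by left; split => //; exists i => //; rewrite i1.
move=> [[Ax [i /andP[i1 ik] Ai]]|[Ax Ak]]; split => //.
  by exists i => //; rewrite i1 ltnW.
by exists k.+1 => //; rewrite leqnn.
Qed.

Lemma measurable_early_hit m A k : measurable A -> measurable (early_hit m A k).
Proof.
move=> mA; elim: k => [|k IHk].
  rewrite (_ : early_hit m A 0 = set0)//; apply/seteqP; split => // x [_ [i]].
  by case: i.
rewrite early_hitS; apply: measurableU => //; apply: measurableI => //.
exact: measurable_preim_times_mod1.
Qed.

Lemma leb01_early_hit m A k : measurable A ->
  leb01 (early_hit m A k) <= \sum_(1 <= i < k.+1) leb01 (A `&` t (m ^ i) @^-1` A).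
Proof.
move=> mA; elim: k => [|k IHk].
  rewrite big_geq// (_ : early_hit m A 0 = set0) ?leb01_set0//.
  by apply/seteqP; split => // x [_ [i]]; case: i.
have mt := measurable_preim_times_mod1 (m ^ k.+1) _ mA.
rewrite big_nat_recr//=; apply: (@le_trans _ _ (leb01 (early_hit m A k) +
    leb01 (A `&` t (m ^ k.+1) @^-1` A))).
  apply: leb01_leU.
  - exact: measurable_early_hit.
  - exact: measurable_early_hit.
  - exact: measurableI.
  - by move=> x _; rewrite early_hitS.
by rewrite lerD2r.
Qed.

(** Splitting off the first iterate, with the invariance of the measure. *)
Lemma leb01_no_hitS m A N : (0 < m)%N -> measurable A ->
  leb01 (no_hit m A N.+1)
  = leb01 (no_hit m A N) - leb01 (A `&` t m @^-1` no_hit m A N).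
Proof.
move=> m0 mA; have mW := measurable_no_hit m _ N mA.
have mt := measurable_preim_times_mod1 m _ mW.
rewrite -[leb01 (no_hit m A N)](leb01_preim m)// -(leb01_setIC (t m @^-1` _) A)//.
rewrite [_ `&` A]setIC addrAC subrr add0r; apply: leb01_eq.
- exact: measurable_no_hit.
- by apply: measurableI => //; exact: measurableC.
- move=> x x01; split => [h|[h1 h2]].
    by split => [i iN|] /=; [rewrite -iterSr; exact: (h i.+1)|exact: (h 0%N)].
  by case=> [_|i iN] //; rewrite iterSr; exact: h1.
Qed.

Lemma leb01_no_hit_sub m A N k : (0 < m)%N -> measurable A ->
  leb01 (no_hit m A N) - k%:R * leb01 A <= leb01 (no_hit m A (N + k)).
Proof.
move=> m0 mA; elim: k => [|k IHk]; first by rewrite mul0r subr0 addn0.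
rewrite addnS leb01_no_hitS//.
have : leb01 (A `&` t m @^-1` no_hit m A (N + k)) <= leb01 A.
  apply: leb01_le => //; last by move=> x _ [].
  apply: measurableI => //; apply: measurable_preim_times_mod1.
  exact: measurable_no_hit.
by rewrite -natr1; lra.
Qed.

Lemma no_hit_le m A N N' : (N <= N')%N -> no_hit m A N' `<=` no_hit m A N.
Proof. by move=> NN x h i iN; apply: h; exact: leq_trans NN. Qed.

(** One step of the recursion, with waiting time l + 1. Avoiding A at the times
1, ..., N implies avoiding A at the times l + 1, ..., N, an event to which
mixing applies; the two events differ on A by early returns only, and the
measure of the second one exceeds [leb01 (no_hit m A N)] by at most l mu(A). *)
Lemma no_hit_step m A N l (d : R) : (0 < m)%N -> measurable A ->
  (forall B, measurable B ->
    `|leb01 (A `&` t (m ^ l.+1) @^-1` B) - leb01 A * leb01 B| <= d) ->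
  `|leb01 (no_hit m A N.+1) - (1 - leb01 A) * leb01 (no_hit m A N)|
  <= d + \sum_(1 <= i < l.+1) leb01 (A `&` t (m ^ i) @^-1` A)
     + l%:R * leb01 A ^+ 2.
Proof.
move=> m0 mA mix.
have mW k := measurable_no_hit m _ k mA.
have mtW a k := measurable_preim_times_mod1 a _ (mW k).
have p0 := leb01_ge0 A.
have := mix _ (mW (N - l)%N); rewrite ler_norml => /andP[mix1 mix2].
have up : leb01 (A `&` t m @^-1` no_hit m A N)
    <= leb01 (A `&` t (m ^ l.+1) @^-1` no_hit m A (N - l)).
  apply: leb01_le; [exact: measurableI|exact: measurableI|].
  move=> x _ [Ax /=]; have tx := times_mod1_itv m x; move=> /(no_hitP _ _ _ _ tx) h.
  split => //=; apply/no_hitP; first exact: times_mod1_itv.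
  move=> i iNl; rewrite times_mod1_comp -expnD addnS expnSr -times_mod1_comp.
  by apply: h; lia.
have lo : leb01 (A `&` t (m ^ l.+1) @^-1` no_hit m A (N - l))
    <= leb01 (A `&` t m @^-1` no_hit m A N)
       + \sum_(1 <= i < l.+1) leb01 (A `&` t (m ^ i) @^-1` A).
  apply: (le_trans _ (_ : leb01 (A `&` t m @^-1` no_hit m A N)
    + leb01 (early_hit m A l) <= _)); last by rewrite lerD2l; exact: leb01_early_hit.
  apply: leb01_leU; [exact: measurableI|exact: measurableI|exact: measurable_early_hit|].
  move=> x _ [Ax /=].
  have tx := times_mod1_itv (m ^ l.+1) x; move=> /(no_hitP _ _ _ _ tx) h.
  have [?|nh] := pselect ((t m @^-1` no_hit m A N) x); [by left|right].
  split => //; apply: contrapT => ne; apply: nh => /=.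
  apply/no_hitP; first exact: times_mod1_itv.
  move=> i iN; rewrite times_mod1_comp -expnSr => Ai; have [il|li] := ltnP i l.
    by apply: ne; exists i.+1.
  apply: (h (i - l)%N); first by lia.
  by rewrite times_mod1_comp -expnD; have -> : (i - l + l.+1 = i.+1)%N by lia.
have q1 : leb01 (no_hit m A N) <= leb01 (no_hit m A (N - l)).
  by apply: leb01_le => // x _; apply: no_hit_le; lia.
have q2 : leb01 (no_hit m A (N - l)) <= leb01 (no_hit m A N) + l%:R * leb01 A.
  have := leb01_no_hit_sub m A (N - l) (N - (N - l)) m0 mA.
  rewrite subnKC ?leq_subr//.
  have : (N - (N - l))%:R * leb01 A <= l%:R * leb01 A by rewrite ler_wpM2r// ler_nat; lia.
  lra.
have q3 := ler_wpM2l p0 q1; have q4 := ler_wpM2l p0 q2.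
rewrite leb01_no_hitS// expr2 ler_norml; apply/andP; split; lra.
Qed.

(** The recursion of [no_hit_step], iterated and compared to that of the
exponential: the cost of replacing 1 - p with exp (- p) is p^2 per step, hence
the factor l + 1 in front of [leb01 A ^+ 2]. *)
Lemma no_hit_exp m A N l (d : R) : (0 < m)%N -> measurable A ->
  (forall B, measurable B ->
    `|leb01 (A `&` t (m ^ l.+1) @^-1` B) - leb01 A * leb01 B| <= d) ->
  `|leb01 (no_hit m A N) - expR (- (N%:R * leb01 A))|
  <= N%:R * (d + \sum_(1 <= i < l.+1) leb01 (A `&` t (m ^ i) @^-1` A)
     + l.+1%:R * leb01 A ^+ 2).
Proof.
move=> m0 mA mix; have p0 := leb01_ge0 A.
set p := leb01 A in p0 *.
have e1 : 1 - p <= expR (- p) by have := expR_ge1Dx (- p).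
have e2 : expR (- p) <= 1 - p + p ^+ 2.
  rewrite expRN; apply: (@le_trans _ _ (1 + p)^-1).
    by rewrite lef_pV2 ?posrE ?expR_gt0 ?expR_ge1Dx//; lra.
  rewrite -[_^-1]mul1r ler_pdivrMr; last by lra.
  by have := exprn_ge0 3 p0; rewrite expr2 !exprS expr0; lra.
set s0 := d + \sum_(1 <= i < l.+1) leb01 (A `&` t (m ^ i) @^-1` A) + l%:R * p ^+ 2.
have -> : d + \sum_(1 <= i < l.+1) leb01 (A `&` t (m ^ i) @^-1` A)
   + l.+1%:R * p ^+ 2 = s0 + p ^+ 2 by rewrite /s0 -natr1; ring.
elim: N => [|N IHN].
  rewrite !mul0r oppr0 expR0 (_ : no_hit m A 0 = [set: R]) ?leb01T ?subrr ?normr0//.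
  by apply/seteqP; split.
have st := no_hit_step m A N l d m0 mA mix; rewrite -/p in st.
rewrite -/s0 in st.
set q := leb01 (no_hit m A N) in st IHN *.
have q0 : 0 <= q := leb01_ge0 _.
have q1 : q <= 1 by apply: leb01_le1; exact: measurable_no_hit.
have -> : expR (- (N.+1%:R * p)) = expR (- (N%:R * p)) * expR (- p).
  by rewrite -expRD -natr1; congr expR; ring.
set a := expR (- (N%:R * p)) in IHN *.
have a0 : 0 < a := expR_gt0 _.
have h0 : expR (- p) <= 1 by rewrite -expR0 ler_expR; lra.
have h1 := expR_gt0 (- p).
rewrite (_ : _ - _ = (leb01 (no_hit m A N.+1) - (1 - p) * q)
   + ((1 - p - expR (- p)) * q + expR (- p) * (q - a))); last by ring.
apply: (le_trans (ler_normD _ _)).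
have st2 : `|(1 - p - expR (- p)) * q| <= p ^+ 2.
  rewrite normrM (ger0_norm q0) -[leRHS]mulr1 ler_pM//.
  by rewrite ler_norml; apply/andP; split; lra.
have st3 : `|expR (- p) * (q - a)| <= N%:R * (s0 + p ^+ 2).
  rewrite normrM (gtr0_norm h1) (le_trans _ IHN)// ler_piMl//.
have st4 := ler_normD ((1 - p - expR (- p)) * q) (expR (- p) * (q - a)).
rewrite -natr1; lra.
Qed.

End hitting.

(** * The steps of the Cantor construction *)
Lemma cantor_codes_even n e : e \in cantor_codes n -> ~~ odd e.
Proof.
elim: n e => [|n IHn] e /=; first by rewrite inE => /eqP ->.
by rewrite mem_cat => /orP[] /mapP[f /IHn fn ->]; rewrite /= ?negbK oddM/= (negbTE fn).
Qed.

Section cantor_step_structure.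
Context {R : realType}.
Implicit Types (x y : R) (N e n : nat).
Local Notation t := (@times_mod1 R).
Local Notation dust := (@cantor_dust R).
Local Notation step := (@cantor_step R).

(** The closed interval [e / N, (e + 1) / N]. *)
Definition closed_cell N e : set R :=
  [set x | e%:R <= N%:R * x <= e.+1%:R].

Lemma closed_cellE N e : (0 < N)%N ->
  closed_cell N e = `[e%:R / N%:R, e.+1%:R / N%:R]%classic.
Proof.
move=> N0; have N0R : 0 < N%:R :> R by rewrite ltr0n.
by apply/seteqP; split => x /=; rewrite in_itv/= /closed_cell/=
  ler_pdivrMr// ler_pdivlMr// mulrC.
Qed.

Lemma middle_third_closed_cell N e x : (0 < N)%N ->
  middle_third (closed_cell N e) x <->
  (3 * e).+1%:R < (3 * N)%:R * x < (3 * e).+2%:R.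
Proof.
move=> N0; have N0R : 0 < N%:R :> R by rewrite ltr0n.
have le_e : e%:R / N%:R <= e.+1%:R / N%:R :> R by rewrite ler_pM2r ?invr_gt0// ler_nat.
rewrite /middle_third closed_cellE// inf_itvcc// sup_itvcc//= in_itv/=.
rewrite -(ltr_pM2l N0R) -[x < _](ltr_pM2l N0R).
have -> : N%:R * (e%:R / N%:R + (e.+1%:R / N%:R - e%:R / N%:R) / 3%:R)
    = e%:R + 1 / 3 :> R by rewrite -natr1; field; rewrite gt_eqF.
have -> : N%:R * (e.+1%:R / N%:R - (e.+1%:R / N%:R - e%:R / N%:R) / 3%:R)
    = e%:R + 2 / 3 :> R by rewrite -natr1; field; rewrite gt_eqF.
rewrite -[(3 * e).+2%:R]natr1 -[(3 * e).+1%:R]natr1 !natrM.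
by split => /andP[h1 h2]; apply/andP; split; lra.
Qed.

(** Intervals with even indices are separated by intervals with odd indices, so
they are the connected components of their union. *)
Lemma connected_component_closed_cells (N e : nat) (s : seq nat) x : (0 < N)%N ->
  (forall f, f \in s -> ~~ odd f) -> e \in s -> closed_cell N e x ->
  connected_component [set y | exists2 f, f \in s & closed_cell N f y] x
  = closed_cell N e.
Proof.
move=> N0 ev es cx; have N0R : 0 < N%:R :> R by rewrite ltr0n.
set S := [set y | _].
apply/seteqP; split; last first.
  apply: connected_component_max => //; first by move=> y cy; exists e.
  by rewrite closed_cellE//; apply/connected_intervalP; exact: interval_is_interval.
have /connected_intervalP CI := @component_connected _ S x.
have Cx : connected_component S x x by apply: connected_component_refl; exists e.
(* The middle of an interval with odd index is outside of S. *)
have gap (g : nat) y : odd g -> N%:R * y = g%:R + 1 / 2 -> ~ S y.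
  move=> og Ny [f fs]; rewrite /closed_cell/= Ny -[f.+1%:R]natr1 => /andP[h1 h2].
  have fg : (f <= g)%N.
    by rewrite -ltnS -(ltr_nat R) -[g.+1%:R]natr1; lra.
  have gf : (g <= f)%N by rewrite -ltnS -(ltr_nat R) -[f.+1%:R]natr1; lra.
  by move: (ev _ fs); rewrite (_ : f = g) ?og//; apply/eqP; rewrite eqn_leq fg.
move=> y Cy; have [f fs cy] := connected_component_sub Cy.
have oe := ev _ es; have of_ := ev _ fs.
move: cx cy; rewrite /closed_cell/= => /andP[x1 x2] /andP[y1 y2].
have mid (g : nat) : N%:R * ((g%:R + 1 / 2) / N%:R) = g%:R + 1 / 2 :> R.
  by field; rewrite gt_eqF.
case: (ltngtP e f) => ef; last by rewrite ef y1.
- have ef2 : (e.+2 <= f)%N.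
    rewrite ltn_neqAle ef andbT; apply/eqP => h.
    by move: of_; rewrite -h /= negbK (negbTE oe).
  exfalso; apply: (gap e.+1 ((e.+1%:R + 1 / 2) / N%:R)); rewrite ?mid//.
  apply: (@connected_component_sub _ _ x); apply: (CI x y) => //.
  rewrite -(ler_nat R) -[e.+2%:R]natr1 -[e.+1%:R]natr1 in ef2; rewrite -natr1 in x2.
  rewrite -(ler_pM2l N0R) -[_ <= y](ler_pM2l N0R) mid -[e.+1%:R]natr1.
  by apply/andP; split; lra.
- have fe2 : (f.+2 <= e)%N.
    rewrite ltn_neqAle ef andbT; apply/eqP => h.
    by move: oe; rewrite -h /= negbK (negbTE of_).
  exfalso; apply: (gap f.+1 ((f.+1%:R + 1 / 2) / N%:R)); rewrite ?mid//.
  apply: (@connected_component_sub _ _ x); apply: (CI y x) => //.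
  rewrite -(ler_nat R) -[f.+2%:R]natr1 -[f.+1%:R]natr1 in fe2; rewrite -natr1 in y2.
  rewrite -(ler_pM2l N0R) -[_ <= x](ler_pM2l N0R) mid -[f.+1%:R]natr1.
  by apply/andP; split; lra.
Qed.

Lemma cantor_stepE n :
  step n = [set x | exists2 e, e \in cantor_codes n & closed_cell (3 ^ n) e x].
Proof.
elim: n => [|n IHn].
  apply/seteqP; split => x /=; rewrite in_itv/=.
    by move=> x01; exists 0%N; rewrite ?inE// /closed_cell/= mul1r.
  by move=> [e]; rewrite inE => /eqP ->; rewrite /closed_cell/= mul1r.
have p3 : (0 < 3 ^ n)%N by rewrite expn_gt0.
have comp e x : e \in cantor_codes n -> closed_cell (3 ^ n) e x ->
    connected_component (step n) x = closed_cell (3 ^ n) e.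
  move=> en cx; rewrite IHn; apply: connected_component_closed_cells => //.
  exact: cantor_codes_even.
apply/seteqP; split => x.
  rewrite /= => -[Cx nmid]; move: (Cx); rewrite IHn => -[e en cx].
  have {nmid} : ~ (3 * e).+1%:R < (3 * 3 ^ n)%:R * x < (3 * e).+2%:R.
    move=> h; apply: nmid; exists x => //; rewrite (comp e)//.
    exact/middle_third_closed_cell.
  move/negP; rewrite negb_and -!leNgt => /orP h; rewrite expnS.
  move: cx; rewrite /closed_cell/= => /andP[h1 h2].
  rewrite -natr1 in h2.
  case: h => h.
    exists (3 * e)%N; first by rewrite mem_cat map_f.
    by apply/andP; split => //; move: h1 h2 h; rewrite !natrM; lra.
  exists (3 * e).+2; first by rewrite mem_cat (map_f (fun e => (3 * e).+2)) ?orbT.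
  by apply/andP; split => //; move: h1 h2 h; rewrite -3!natr1 !natrM; lra.
move=> [g]; rewrite expnS => gn cg /=.
have [e en [cx ge]] : exists2 e, e \in cantor_codes n & closed_cell (3 ^ n) e x
    /\ (g = 3 * e \/ g = (3 * e).+2)%N.
  move: gn cg; rewrite /= mem_cat => /orP[] /mapP[e en ->] /andP[h1 h2]; exists e => //.
    split; last by left.
    by move: h1 h2; rewrite /closed_cell/= -!natr1 !natrM => h1 h2; apply/andP; split; lra.
  split; last by right.
  by move: h1 h2; rewrite /closed_cell/= -!natr1 !natrM => h1 h2; apply/andP; split; lra.
split; first by rewrite IHn; exists e.
move=> [y]; rewrite {1}IHn => -[f fn cy]; rewrite (comp f y fn cy).
move/(middle_third_closed_cell _ _ _ p3) => /andP[k1 k2].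
move: cg => /andP[h1 h2].
have l1 := le_lt_trans h1 k2; have l2 := lt_le_trans k1 h2.
by rewrite !ltr_nat in l1 l2; lia.
Qed.

Lemma measurable_closed_cells N (s : seq nat) : (0 < N)%N ->
  measurable [set x | exists2 e, e \in s & closed_cell N e x].
Proof.
move=> N0; elim: s => [|e s IHs].
  by rewrite (_ : mkset _ = set0)//; apply/seteqP; split => // x [].
rewrite (_ : mkset _ = closed_cell N e `|`
    [set x | exists2 e, e \in s & closed_cell N e x]).
  by apply: measurableU => //; rewrite closed_cellE//; exact: measurable_itv.
apply/seteqP; split => x.
  by move=> [f]; rewrite inE => /orP[/eqP ->|fs] cf; [left|right; exists f].
by move=> [ce|[f fs cf]]; [exists e => //; rewrite mem_head|exists f; rewrite // inE fs orbT].
Qed.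

Lemma measurable_cantor_step n : measurable (step n).
Proof. by rewrite cantor_stepE; apply: measurable_closed_cells; rewrite expn_gt0. Qed.

Lemma cantor_dust_sub_step n : dust n `<=` step n.
Proof.
move=> x /cantor_dustP[e en /andP[h1 h2]]; rewrite cantor_stepE; exists e => //.
by rewrite /closed_cell/= h1 ltW.
Qed.

(** The two sets differ by right end points only. *)
Lemma leb01_stepD_dust n : leb01 (step n `\` dust n) = 0.
Proof.
have p3 : (3 ^ n)%:R != 0 :> R by rewrite pnatr_eq0 -lt0n expn_gt0.
apply: leb01_finite; last first.
  by apply: measurableD; [exact: measurable_cantor_step|exact: measurable_cantor_dust].
pose ends := [seq e.+1%:R / (3 ^ n)%:R : R | e <- cantor_codes n].
apply: (@sub_finite_set _ _ [set` ends]); last exact: finite_seq.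
move=> x []; rewrite cantor_stepE => -[e en /andP[h1 h2]] nd /=.
apply/mapP; exists e => //.
suff -> : e.+1%:R = (3 ^ n)%:R * x by rewrite mulrAC mulfV// mul1r.
apply/eqP; rewrite eq_le h2 andbT leNgt; apply/negP => h3; apply: nd.
by apply/cantor_dustP; exists e => //; rewrite /cell/= h1.
Qed.

Lemma leb01_stepI n S : measurable S ->
  leb01 (step n `&` S) = leb01 (dust n `&` S).
Proof.
move=> mS; have mC := measurable_cantor_step n; have mD := @measurable_cantor_dust R n.
apply/eqP; rewrite eq_le; apply/andP; split; last first.
  apply: leb01_le; [exact: measurableI|exact: measurableI|].
  by move=> x _ [/cantor_dust_sub_step].
rewrite -[leRHS]addr0 -(leb01_stepD_dust n).
apply: leb01_leU; [exact: measurableI|exact: measurableI|exact: measurableD|].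
move=> x _ [Cx Sx]; have [Dx|nDx] := pselect (dust n x); [by left|by right].
Qed.

Lemma leb01_step n : leb01 (step n) = (2 / 3) ^+ n.
Proof. by rewrite -[step n]setIT leb01_stepI// setIT leb01_cantor_dust. Qed.

Lemma leb01_step_returns M n : (0 < M)%N ->
  leb01 (step n `&` t M @^-1` step n) <= leb01 (@returns R M n).
Proof.
move=> M0.
have mC := measurable_cantor_step n; have mD := @measurable_cantor_dust R n.
have mCD : measurable (step n `\` dust n) by exact: measurableD.
have mtC := measurable_preim_times_mod1 M _ mC.
have mtCD := measurable_preim_times_mod1 M _ mCD.
rewrite leb01_stepI// -[leRHS]addr0 -(leb01_stepD_dust n) -(leb01_preim M _ M0 mCD).
apply: leb01_leU => //; [exact: measurableI|exact: measurable_returns|].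
move=> x _ [Dx Ctx]; have [Dtx|nDtx] := pselect (dust n (t M x)); [by left|by right].
Qed.

Lemma cantor_ladder_gt n x : 0 <= x <= 1 ->
  (n%:R%:E < cantor_ladder x)%E <-> step n x.
Proof.
move=> x01; have st0 : step 0 x by rewrite /= in_itv.
split.
  apply: contraPP => nC; apply/negP; rewrite -leNgt.
  have [k [k1 kn gk]] : exists k, [/\ (1 <= k)%N, (k <= n)%N & cantor_gap k x].
    elim: n nC => // n IHn nC.
    have [Cn|nCn] := pselect (step n x); first by exists n.+1; split => //; split.
    by have [k [k1 kn gk]] := IHn nCn; exists k; split => //; rewrite leqW.
  by rewrite (cantor_ladder_gap k1 gk) lee_fin ler_nat.
move=> Cn; rewrite /cantor_ladder; case: pselect => h; last by rewrite ltry.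
case: cid => k /= [k1 [_ kx]]; rewrite lte_fin ltr_nat ltnNge; apply/negP => kn.
by apply: kx; apply: cantor_step_le Cn.
Qed.

End cantor_step_structure.

(** * Asymptotics *)
Section asymptotics.
Context {R : realType}.

Lemma w_itv (tau : R) n : 0 <= tau ->
  (w tau n)%:R <= tau * (3 / 2) ^+ n < (w tau n)%:R + 1.
Proof.
move=> tau0; rewrite natr1; apply: truncn_itv.
by rewrite mulr_ge0// exprn_ge0// divr_ge0.
Qed.

Lemma w_cvg (tau : R) : 0 <= tau ->
  (w tau n)%:R * (2 / 3) ^+ n @[n --> \oo] --> tau.
Proof.
move=> tau0; apply/cvgrPdist_lt => e e0.
have q1 : `|2 / 3 : R| < 1 by rewrite ger0_norm; lra.
have /cvgrPdist_lt/(_ _ e0)[n0 _ hn0] := cvg_expr q1.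
exists n0 => // n /hn0 /=; rewrite sub0r normrN.
have p0 : 0 < (2 / 3) ^+ n :> R by rewrite exprn_gt0.
rewrite gtr0_norm// => pe; apply: le_lt_trans pe.
have /andP[h1 h2] := w_itv _ n tau0.
have e1 : (3 / 2) ^+ n * (2 / 3) ^+ n = 1 :> R.
  by rewrite -exprMn (_ : 3 / 2 * (2 / 3) = 1) ?expr1n//; field.
have h3 := ler_wpM2r (ltW p0) h1; have h4 := ler_wpM2r (ltW p0) (ltW h2).
rewrite -mulrA e1 mulr1 in h3 h4; rewrite mulrDl mul1r in h4.
by rewrite ler_norml; apply/andP; split; lra.
Qed.

Lemma natr_exp23_le n : n%:R * (2 / 3) ^+ n <= 3 * (8 / 9) ^+ n :> R.
Proof.
have h : n%:R <= 3 * (4 / 3) ^+ n :> R.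
  elim: n => [|n IHn]; first by rewrite expr0; lra.
  have : 1 <= (4 / 3) ^+ n :> R by apply: exprn_ege1; lra.
  by rewrite -[n.+1%:R]natr1 exprS; lra.
have -> : 8 / 9 = 4 / 3 * (2 / 3) :> R by field.
by rewrite (exprMn n (4 / 3)) [leRHS]mulrA ler_wpM2r// exprn_ge0// divr_ge0.
Qed.

(** No measurability is required, so that events described through
[cantor_ladder] can be rewritten first. *)
Lemma mu_ext (A B : set R) : (forall x, 0 <= x <= 1 -> A x <-> B x) -> mu A = mu B.
Proof.
move=> AB; rewrite /mu /mrestr; congr (lebesgue_measure _).
apply/seteqP; split => x [+ /=]; rewrite in_itv/= => + x01.
  by move=> /(AB x x01).
by move=> /(AB x x01).
Qed.

Lemma mu_exceed m n : mu [set x : R | X m 0 x > u R n]%E = ((2 / 3) ^+ n)%:E.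
Proof.
rewrite (mu_ext _ (cantor_step n)); last by move=> x x01; exact: cantor_ladder_gt.
by rewrite -leb01K ?leb01_step//; exact: measurable_cantor_step.
Qed.

Lemma mu_max_le m N n :
  mu [set x : R | M m N x <= u R n]%E = (leb01 (no_hit m (@cantor_step R n) N))%:E.
Proof.
rewrite leb01K; last by apply: measurable_no_hit; exact: measurable_cantor_step.
apply: mu_ext => x x01.
have it01 i : 0 <= iter i (times_mod1 m) x <= 1.
  by case: i => [//|i]; have /andP[-> /ltW ->] := times_mod1_itv m (iter i (times_mod1 m) x).
split.
  move=> /bigmax_leP[_ h] i iN; move/(cantor_ladder_gt _ _ (it01 i)).
  by apply/negP; rewrite -leNgt; exact: (h (Ordinal iN)).
move=> h; apply/bigmax_leP; split; first exact: leNye.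
move=> i _; rewrite leNgt; apply/negP => /(cantor_ladder_gt _ _ (it01 i)).
by apply: h.
Qed.

(** [no_hit_exp] for the set [cantor_step n] and the waiting time 2n, with the
three error terms divided by the measure (2/3)^n of this set. *)
Lemma no_hit_cantor_step_exp m N n : (2 <= m)%N -> (1 <= n)%N ->
  `|leb01 (no_hit m (@cantor_step R n) N) - expR (- (N%:R * (2 / 3) ^+ n))|
  <= N%:R * (2 / 3) ^+ n * (2 * (3 / 4) ^+ n
     + (\sum_(1 <= j < 2 * n) leb01 (@returns R (m ^ j) n)) / (2 / 3) ^+ n
     + 6 * (8 / 9) ^+ n).
Proof.
move=> m2 n1; have m0 : (0 < m)%N by lia.
have n2 : (2 * n).-1.+1 = (2 * n)%N by lia.
have mC := @measurable_cantor_step R n.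
have p0 : 0 < (2 / 3) ^+ n :> R by rewrite exprn_gt0.
have mix (B : set R) : measurable B ->
  `|leb01 (cantor_step n `&` times_mod1 (m ^ (2 * n).-1.+1) @^-1` B)
    - leb01 (cantor_step n) * leb01 B| <= 2 * (1 / 2) ^+ n.
  move=> mB; rewrite leb01_stepI; last exact: measurable_preim_times_mod1.
  rewrite leb01_step n2.
  have m20 : (0 < m ^ (2 * n))%N by rewrite expn_gt0 m0.
  apply: (le_trans (cantor_dust_mixing _ n _ m20 mB)).
  rewrite mulrCA ler_pM2l//.
  have m4 : 4 ^+ n <= (m ^ (2 * n))%:R :> R.
    by rewrite -natrX ler_nat expnM leq_exp2r//; nia.
  have p4 : 0 < 4 ^+ n :> R by rewrite exprn_gt0.
  have -> : (1 / 2) ^+ n = 2 ^+ n / 4 ^+ n :> R.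
    by rewrite -expr_div_n; congr (_ ^+ n); field.
  rewrite ler_pM2l ?exprn_gt0// -[leRHS]mul1r ler_pM ?leb01_ge0 ?leb01_le1 ?invr_ge0//.
  by rewrite lef_pV2 ?posrE// (lt_le_trans p4).
have := no_hit_exp m (cantor_step n) N (2 * n).-1 _ m0 mC mix.
rewrite leb01_step n2 => /le_trans; apply.
rewrite -[leRHS]mulrA ler_wpM2l// 2!mulrDr; apply: lerD; first apply: lerD.
- rewrite le_eqVlt; apply/orP; left; apply/eqP.
  rewrite mulrCA -exprMn; congr (_ * _ ^+ n); by field.
- rewrite mulrC divfK ?gt_eqF//.
  by apply: ler_sum => i _; apply: leb01_step_returns; rewrite expn_gt0 m0.
- rewrite expr2 mulrA mulrC ler_pM2l// natrM.
  by have := natr_exp23_le n; lra.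
Qed.

End asymptotics.

Theorem theorem3p2 (R : realType) (m : nat) (tau : R) :
  (2 <= m)%N ->
  (forall k : nat, (1 <= k)%N -> m <> (3 ^ k)%N) ->
  0 <= tau ->
  ((w tau n)%:R%:E * mu [set x : R | X m 0 x > u R n])%E @[n --> \oo]
      --> tau%:E /\
  mu [set x : R | M m (w tau n) x <= u R n]%E @[n --> \oo]
      --> (expR (- tau))%:E.
Proof.
move=> m2 m3 tau0; have wc := w_cvg _ tau0; split.
  under eq_fun do rewrite mu_exceed -EFinM.
  by apply: cvg_EFin; [exact: nearW|exact: wc].
under eq_fun do rewrite mu_max_le.
apply: cvg_EFin; first exact: nearW.
pose h n : R := (w tau n)%:R * (2 / 3) ^+ n.
have hexp : expR (- h n) @[n --> \oo] --> expR (- tau).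
  by apply: continuous_cvg; [exact: continuous_expR|exact: cvgN].
pose b n : R := h n * (2 * (3 / 4) ^+ n
     + (\sum_(1 <= j < 2 * n) leb01 (@returns R (m ^ j) n)) / (2 / 3) ^+ n
     + 6 * (8 / 9) ^+ n).
have b0 : b n @[n --> \oo] --> (0 : R).
  rewrite -(mulr0 tau); apply: cvgM => //.
  have geo (c q : R) : 0 <= q < 1 -> c * q ^+ n @[n --> \oo] --> (0 : R).
    move=> /andP[q0 q1]; rewrite -(mulr0 c); apply: cvgMr; apply: cvg_expr.
    by rewrite ger0_norm.
  have g1 : 2 * (3 / 4) ^+ n @[n --> \oo] --> (0 : R).
    by apply: geo; apply/andP; split; lra.
  have g2 : 6 * (8 / 9) ^+ n @[n --> \oo] --> (0 : R).
    by apply: geo; apply/andP; split; lra.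
  have := cvgD (cvgD g1 (sum_returns_cvg0 m m2 m3)) g2.
  by rewrite !addr0; apply.
apply: (@squeeze_cvgr _ _ _ _ (fun n => expR (- h n) - b n)
                              (fun n => expR (- h n) + b n)).
- exists 1%N => // n /= n1.
  have := @no_hit_cantor_step_exp R m (w tau n) n m2 n1.
  rewrite -/(h n) -/(b n) ler_norml => /andP[h1 h2].
  by apply/andP; split; lra.
- by rewrite -[X in _ --> X]subr0; exact: cvgB.
- by rewrite -[X in _ --> X]addr0; exact: cvgD.
Qed.
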